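(* Let $(\Omega,\rightarrow,\triangleright)$ be a finite non-degenerate CEDS. Then there exist an abelian group $(\Omega_1,* )$, a group $(\Omega_2,\star)$, a left action $\succ\colon\Omega_2\times\Omega_1\longrightarrow\Omega_1$ of $(\Omega_2,\star)$ on $(\Omega_1,* )$ by group automorphisms, and a nonempty set $\Omega_3$ such that $(\Omega,\rightarrow,\triangleright)$ is isomorphic to the CEDS $(\mathbf{EAS}(\Omega_1,* )\rtimes_\succ \mathbf{EAS}'(\Omega_2,\star))\times\mathbf{EAS}(\Omega_3)$, that is to say, to the set $\Omega_1\times\Omega_2\times\Omega_3$ with the products given by \[(\alpha_1,\alpha_2,\alpha_3)\rightarrow(\beta_1,\beta_2,\beta_3)=(\alpha_1*\beta_1,\beta_2,\beta_3),\] \[(\alpha_1,\alpha_2,\alpha_3)\triangleright(\beta_1,\beta_2,\beta_3)=\bigl(\beta_2\succ\alpha_1,\ \alpha_2\star\beta_2^{\star-1},\ \alpha_3\bigr),\] where $\beta_2^{\star -1}$ is the inverse of $\beta_2$ in $(\Omega_2,\star)$.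
   Context: A commutative extended diassociative semigroup (CEDS) is a triple $(\Omega,\rightarrow,\triangleright)$, where $\Omega$ is a nonempty set and $\rightarrow,\triangleright\colon\Omega^2\to\Omega$ are maps such that for all $\alpha,\beta,\gamma\in\Omega$: $\alpha\rightarrow(\beta\rightarrow\gamma)=(\alpha\rightarrow\beta)\rightarrow\gamma=(\beta\rightarrow\alpha)\rightarrow\gamma$; $\alpha\triangleright(\beta\rightarrow\gamma)=\alpha\triangleright\gamma$; $(\alpha\triangleright\gamma)\rightarrow(\beta\triangleright\gamma)=(\alpha\rightarrow\beta)\triangleright\gamma$; $(\alpha\triangleright\gamma)\triangleright(\beta\triangleright\gamma)=\alpha\triangleright\beta$. It is non-degenerate if the map $\phi\colon\Omega^2\to\Omega^2$, $\phi(\alpha,\beta)=(\alpha\rightarrow\beta,\alpha\triangleright\beta)$, is bijective. An isomorphism is a bijection compatible with both operations. *)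

(* Defs.v *)
From HB Require Import structures.
From mathcomp Require Import all_boot all_algebra.

Set Implicit Arguments.
Unset Strict Implicit.
Unset Printing Implicit Defensive.

Record is_CEDS (Omega : Type) (arr tri : Omega -> Omega -> Omega) : Prop := {
  CEDS_nonempty : inhabited Omega;
  CEDS_arrA : forall a b c, arr a (arr b c) = arr (arr a b) c;
  CEDS_arr_comm : forall a b c, arr (arr a b) c = arr (arr b a) c;
  CEDS_tri_arr : forall a b c, tri a (arr b c) = tri a c;
  CEDS_arr_tri : forall a b c, arr (tri a c) (tri b c) = tri (arr a b) c;
  CEDS_tri_tri : forall a b c, tri (tri a c) (tri b c) = tri a b
}.

Definition CEDS_nondegenerate (Omega : Type) (arr tri : Omega -> Omega -> Omega)
    : Prop :=
  bijective (fun p : Omega * Omega => (arr p.1 p.2, tri p.1 p.2)).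

Definition CEDS_isomorphic (A B : Type)
    (arrA triA : A -> A -> A) (arrB triB : B -> B -> B) : Prop :=
  exists f : A -> B,
    [/\ bijective f,
        forall x y, f (arrA x y) = arrB (f x) (f y) &
        forall x y, f (triA x y) = triB (f x) (f y)].

(* The library's actions are right actions; here the action is on the left,
   and the abelian group is a zmodType, written additively. *)
Record is_left_aut_action (G : groupType) (V : zmodType) (act : G -> V -> V)
    : Prop := {
  act_one : forall v, act 1%g v = v;
  act_mul : forall g h v, act (g * h)%g v = act g (act h v);
  act_add : forall g u v, act g (u + v)%R = (act g u + act g v)%R;
  act_bij : forall g, bijective (act g)
}.

(* (EAS(V, +) \rtimes_act EAS'(G, * )) \times EAS(S) *)
Definition model_arr (V : zmodType) (G : groupType) (S : Type)
    (x y : V * G * S) : V * G * S :=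
  let: (a1, a2, a3) := x in
  let: (b1, b2, b3) := y in
  ((a1 + b1)%R, b2, b3).

Definition model_tri (V : zmodType) (G : groupType) (S : Type)
    (act : G -> V -> V) (x y : V * G * S) : V * G * S :=
  let: (a1, a2, a3) := x in
  let: (b1, b2, b3) := y in
  (act b2 a1, (a2 * b2^-1)%g, a3).

Lemma model_is_CEDS (V : zmodType) (G : groupType) (S : Type)
    (act : G -> V -> V) :
  is_left_aut_action act -> inhabited S ->
  is_CEDS (@model_arr V G S) (@model_tri V G S act).
Proof.
move=> [_ actM actD _] [s]; split.
- by split; exact: (0%R, 1%g, s).
- by move=> [[a1 a2] a3] [[b1 b2] b3] [[c1 c2] c3] /=; rewrite GRing.addrA.
- by move=> [[a1 a2] a3] [[b1 b2] b3] [[c1 c2] c3] /=; rewrite (GRing.addrC a1).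
- by move=> [[a1 a2] a3] [[b1 b2] b3] [[c1 c2] c3].
- by move=> [[a1 a2] a3] [[b1 b2] b3] [[c1 c2] c3] /=; rewrite actD.
move=> [[a1 a2] a3] [[b1 b2] b3] [[c1 c2] c3] /=.
by rewrite -actM divgK invgF mulgA divgK.
Qed.

(* Main.v *)
Require Import Defs.
From HB Require Import structures.
From mathcomp Require Import all_boot all_algebra.
From mathcomp Require Import all_fingroup finmodule.

Set Implicit Arguments.
Unset Strict Implicit.
Unset Printing Implicit Defensive.

Import GroupScope FiniteModule.

(** Write L_a for the left translation x |-> arr a x and T_c for the right
    translation x |-> tri x c. Non-degeneracy makes all of them surjective,
    hence, Omega being finite, bijective ([tri_inj], [arr_inj]). The axioms then
    become identities between permutations:
      - L_(arr a b) is the composite of L_a and L_b, which commute;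
      - T_(arr a c) = T_c;
      - T_c is an automorphism of arr, so L_(tri a c) is the conjugate of L_a
        by T_c;
      - T_(tri b c) is T_b after the inverse of T_c.
    By the first identity the L_a form an abelian group A. By the last one the
    permutations kappa_c := T_c^-1 satisfy
    kappa_(tri b c) = kappa_b * (kappa_c)^-1, where the left factor of a product
    of permutations is applied first; they are closed under division
    and form a group K, which normalises A by the third identity.

    The group A moves points while changing L in a regular way and T not at all
    ([arr_perm_shift], [tri_perm_shift]); K moves points while changing T in a
    regular way, and it preserves the points with trivial L ([arr_perm_act],
    [tri_perm_act]). Hence every point is p (g s) for unique p in A and g in K
    and a unique s for which L_s and T_s are both trivial: p has to be L_x, g
    has to be kappa_x, and then s is determined ([coordsK], [pointK]). In the
    coordinates (p, g, s) the identities above are the product formulas of the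
    model, with K acting on A by conjugation ([coords_arr], [coords_tri]). *)

Lemma surj_inj (T : finType) (f : T -> T) :
  (forall y, exists x, f x = y) -> injective f.
Proof.
move=> fS; apply/injectiveP/card_uniqP; rewrite size_map -cardE.
by apply: eq_card => y; rewrite inE; case: (fS y) => x <-; rewrite codom_f.
Qed.

Section Translations.

Variables (Omega : finType) (arr tri : Omega -> Omega -> Omega).
Hypotheses (hC : is_CEDS arr tri) (hnd : CEDS_nondegenerate arr tri).

(** The preimage (a, b) of (c, y) under the structure map has arr a b = c, and
    tri does not distinguish b from arr a b. *)
Lemma tri_surj c y : exists a, tri a c = y.
Proof.
case: hnd => g _ /(_ (c, y)) [].
case: (g _) => a b /= <- <-; exists a.
by rewrite (CEDS_tri_arr hC).
Qed.

Lemma tri_inj c : injective (tri^~ c).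
Proof. exact/surj_inj/tri_surj. Qed.

(** The preimage of (x, tri a x) is a pair (a', b) with arr a' b = x and
    tri a' x = tri a x; injectivity of tri forces a' = a. *)
Lemma arr_surj a x : exists b, arr a b = x.
Proof.
case: hnd => g _ /(_ (x, tri a x)) [].
case: (g _) => a' b /= eq_x; rewrite -eq_x (CEDS_tri_arr hC).
by move/tri_inj=> eq_a; exists b; rewrite -eq_a.
Qed.

Lemma arr_inj a : injective (arr a).
Proof. exact/surj_inj/arr_surj. Qed.

Definition arr_perm a : {perm Omega} := perm (@arr_inj a).
Definition tri_perm c : {perm Omega} := perm (@tri_inj c).

Lemma arr_permE a x : arr_perm a x = arr a x.
Proof. exact: permE. Qed.

Lemma tri_permE c x : tri_perm c x = tri x c.
Proof. exact: permE. Qed.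

(** Permutations compose from left to right, so associativity yields the product
    in the order b, a; left commutativity exchanges the factors. *)
Lemma arr_perm_arr a b : arr_perm (arr a b) = arr_perm a * arr_perm b.
Proof.
apply/permP=> x; rewrite permM !arr_permE.
by rewrite (CEDS_arrA hC) (CEDS_arr_comm hC).
Qed.

Lemma arr_permC a b : commute (arr_perm a) (arr_perm b).
Proof.
rewrite /commute -!arr_perm_arr.
by apply/permP=> x; rewrite !arr_permE (CEDS_arr_comm hC).
Qed.

(** Right translations by tri are automorphisms of arr. *)
Lemma arr_perm_tri a c : arr_perm (tri a c) = arr_perm a ^ tri_perm c.
Proof.
apply/permP=> x; rewrite -(permKV (tri_perm c) x) permJ.
by rewrite !(arr_permE, tri_permE) (CEDS_arr_tri hC).
Qed.

Lemma tri_perm_arr a c : tri_perm (arr a c) = tri_perm c.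
Proof. by apply/permP=> x; rewrite !tri_permE (CEDS_tri_arr hC). Qed.

Lemma tri_perm_tri b c : tri_perm (tri b c) = (tri_perm c)^-1 * tri_perm b.
Proof.
apply: (mulgI (tri_perm c)); rewrite mulKVg.
by apply/permP=> x; rewrite permM !tri_permE (CEDS_tri_tri hC).
Qed.

Lemma arr_perm_group_set : group_set [set arr_perm a | a : Omega].
Proof.
apply/group_setP; split=> [|_ _ /imsetP[a _ ->] /imsetP[b _ ->]]; last first.
  by rewrite -arr_perm_arr imset_f.
(* A point e with arr a e = a acts as the identity, by cancelling L_a. *)
case: (CEDS_nonempty hC) => a; have [e def_a] := arr_surj a a.
apply/imsetP; exists e => //; apply: (mulgI (arr_perm a)).
by rewrite -arr_perm_arr def_a mulg1.
Qed.

Definition arr_group : {group {perm Omega}} := Group arr_perm_group_set.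

Lemma arr_group_abelian : abelian arr_group.
Proof.
apply/centsP=> _ /imsetP[a _ ->] _ /imsetP[b _ ->]; exact: arr_permC.
Qed.

(** The inverses are used because the model divides on the right in its second
    coordinate, while [tri_perm_tri] divides on the left. *)
Lemma tri_perm_group_set : group_set [set (tri_perm c)^-1 | c : Omega].
Proof.
set K := [set _ | _ in _].
have divK g h : g \in K -> h \in K -> g * h^-1 \in K.
  case/imsetP=> b _ -> /imsetP[c _ ->].
  by apply/imsetP; exists (tri b c); rewrite // tri_perm_tri invMg.
have K1 : 1 \in K.
  case: (CEDS_nonempty hC) => c.
  by rewrite -(mulgV (tri_perm c)^-1); apply: divK; exact: imset_f.
apply/group_setP; split=> // g h Kg Kh.
rewrite -(invgK h); apply: (divK) => //.
by rewrite -(mul1g h^-1); apply: divK.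
Qed.

Definition tri_group : {group {perm Omega}} := Group tri_perm_group_set.

Lemma tri_group_norm : tri_group \subset 'N(arr_group).
Proof.
apply/subsetP=> _ /imsetP[c _ ->]; rewrite groupV inE.
apply/subsetP=> _ /imsetP[_ /imsetP[a _ ->] ->].
by rewrite -arr_perm_tri imset_f.
Qed.

Lemma arr_perm_in a : arr_perm a \in arr_group. Proof. exact: imset_f. Qed.

Lemma tri_permV_in c : (tri_perm c)^-1 \in tri_group.
Proof. exact: imset_f. Qed.

Lemma arr_perm_shift p x :
  p \in arr_group -> arr_perm (p x) = p * arr_perm x.
Proof. by case/imsetP=> a _ ->; rewrite arr_permE arr_perm_arr. Qed.

Lemma tri_perm_shift p x : p \in arr_group -> tri_perm (p x) = tri_perm x.
Proof. by case/imsetP=> a _ ->; rewrite arr_permE tri_perm_arr. Qed.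

(** A group contains the inverses of its elements, so the right translations
    themselves make up the same group. *)
Lemma tri_groupP g : reflect (exists c, g = tri_perm c) (g \in tri_group).
Proof.
rewrite -groupV; apply: (iffP imsetP) => [[c _ /invg_inj] | [c ->]].
  by exists c.
by exists c.
Qed.

Lemma arr_perm_act g x : g \in tri_group -> arr_perm (g x) = arr_perm x ^ g.
Proof. by case/tri_groupP=> c ->; rewrite tri_permE arr_perm_tri. Qed.

Lemma tri_perm_act g x : g \in tri_group -> tri_perm (g x) = g^-1 * tri_perm x.
Proof. by case/tri_groupP=> c ->; rewrite tri_permE tri_perm_tri. Qed.

Definition neutral := {x : Omega | (arr_perm x == 1) && (tri_perm x == 1)}.

(** The unique neutral point s with x = L_x (T_x^-1 s). *)
Definition neutral_rep x := tri_perm x ((arr_perm x)^-1 x).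

Lemma neutral_rep_neutral x :
  (arr_perm (neutral_rep x) == 1) && (tri_perm (neutral_rep x) == 1).
Proof.
have tK : tri_perm x \in tri_group by rewrite -groupV tri_permV_in.
have LA : (arr_perm x)^-1 \in arr_group by rewrite groupV arr_perm_in.
rewrite arr_perm_act // tri_perm_act // tri_perm_shift // mulVg eqxx andbT.
by rewrite arr_perm_shift // mulVg conj1g.
Qed.

Definition neutral_part x : neutral :=
  Sub (neutral_rep x) (neutral_rep_neutral x).

Definition arr_module := fmod_of arr_group_abelian.

Definition tri_subgroup := subg_of tri_group.

(** The inverse turns the right action by conjugation into a left action; it
    also matches the model, where the action is by kappa_y while
    [arr_perm_tri] conjugates by T_y = kappa_y^-1. *)
Definition tri_act (g : tri_subgroup) (v : arr_module) : arr_module :=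
  actr v (sgval g)^-1.

Lemma tri_act_left_aut : is_left_aut_action tri_act.
Proof.
have gN (g : tri_subgroup) : (sgval g)^-1 \in 'N(arr_group).
  by rewrite groupV (subsetP tri_group_norm) ?subgP.
have act1 v : tri_act 1 v = v by rewrite /tri_act /= invg1 actr1.
have actM g h v : tri_act (g * h) v = tri_act g (tri_act h v).
  by rewrite /tri_act /= invMg actrM.
split=> //.
  by move=> g u v; exact: actAr.
move=> g; exists (tri_act g^-1) => v.
  by rewrite -actM mulVg act1.
by rewrite -actM mulgV act1.
Qed.

Definition coords x : arr_module * tri_subgroup * neutral :=
  (fmod arr_group_abelian (arr_perm x), subg tri_group (tri_perm x)^-1,
   neutral_part x).

Definition point (u : arr_module * tri_subgroup * neutral) : Omega :=
  let: (v, g, s) := u in fmval v (sgval g (val s)).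

Lemma coordsK : cancel coords point.
Proof.
move=> x; rewrite /= fmodK ?arr_perm_in // subgK ?tri_permV_in //.
by rewrite permK permKV.
Qed.

Lemma pointK : cancel point coords.
Proof.
case=> [[v g] [s /= s1]]; case/andP: (s1) => /eqP Ls /eqP Ts.
have vA := fmodP v; have gK := subgP g.
have Lp : arr_perm (fmval v (sgval g s)) = fmval v.
  by rewrite arr_perm_shift // arr_perm_act // Ls conj1g mulg1.
have Tp : tri_perm (fmval v (sgval g s)) = (sgval g)^-1.
  by rewrite tri_perm_shift // tri_perm_act // Ts mulg1.
rewrite /coords Lp Tp fmvalK invgK sgvalK; congr (_, _, _).
by apply: val_inj; rewrite /= /neutral_rep Lp Tp !permK.
Qed.

(** L_x cancels: the inverse of L_(arr x y) sends arr x y to L_y^-1 y, so the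
    neutral coordinate is that of y. *)
Lemma coords_arr x y : coords (arr x y) = model_arr (coords x) (coords y).
Proof.
rewrite /coords /= tri_perm_arr arr_perm_arr fmodM ?arr_perm_in //.
congr (_, _, _); apply: val_inj; rewrite /= /neutral_rep.
by rewrite tri_perm_arr arr_perm_arr arr_permC invMg permM -arr_permE permK.
Qed.

(** The factors T_y cancel: conjugation by T_y carries L_x^-1 x to its image
    under T_y, which T_(tri x y) sends to T_x (L_x^-1 x), so the neutral
    coordinate is that of x. *)
Lemma coords_tri x y :
  coords (tri x y) = model_tri tri_act (coords x) (coords y).
Proof.
have yK := tri_permV_in y; have xK := tri_permV_in x.
rewrite /coords /=; congr (_, _, _).
- rewrite /tri_act subgK // invgK arr_perm_tri fmodJ //.
  by rewrite (subsetP tri_group_norm) // -groupV.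
- rewrite tri_perm_tri invMg; apply: val_inj.
  by rewrite /= !subgK // groupM // groupV.
apply: val_inj; rewrite /= /neutral_rep.
by rewrite tri_perm_tri arr_perm_tri -conjVg -tri_permE permJ permM permK.
Qed.

End Translations.

Theorem theorem3p16 (Omega : finType) (arr tri : Omega -> Omega -> Omega)
    (hCEDS : is_CEDS arr tri) (hnd : CEDS_nondegenerate arr tri) :
  exists (Omega1 : zmodType) (Omega2 : groupType)
         (act : Omega2 -> Omega1 -> Omega1) (Omega3 : Type),
    [/\ is_left_aut_action act,
        inhabited Omega3 &
        CEDS_isomorphic arr tri
          (@model_arr Omega1 Omega2 Omega3)
          (@model_tri Omega1 Omega2 Omega3 act)].
Proof.
exists (arr_module hCEDS hnd), (tri_subgroup hCEDS hnd).
exists (@tri_act _ _ _ hCEDS hnd).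
exists (neutral hCEDS hnd); split; first exact: tri_act_left_aut.
  by case: (CEDS_nonempty hCEDS) => x; exists; exact: neutral_part x.
exists (coords hCEDS hnd); split=> [|x y|x y].
- by exists (point (hnd := hnd)); [exact: coordsK | exact: pointK].
- exact: coords_arr.
exact: coords_tri.
Qed.
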